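(* Let $I$ be an interval, let $n\in\mathbb{N}$, and for $1\le i\le n$ let $f_i$ be logarithmically completely monotonic on $I$ and let $\alpha_i\ge 0$ be a real number. Then the function $x\mapsto\prod_{i=1}^n [f_i(x)]^{\alpha_i}$ is logarithmically completely monotonic on $I$.
   Context: $\mathbb{N}=\{1,2,\dots\}$. A positive function $f$ on an interval $I$ is called logarithmically completely monotonic on $I$ if it has derivatives of all orders on $I$ and $(-1)^k[\ln f(x)]^{(k)}\ge 0$ for all $x\in I$ and all $k\in\mathbb{N}$. *)

(* Defs.v *)
From Stdlib Require Import Reals.

Local Open Scope R_scope.

(* The interval may be open, closed, half-open or unbounded. *)
Definition is_interval (I : R -> Prop) : Prop :=
  forall a b x : R, I a -> I b -> a <= x <= b -> I x.

(* [D_in] is the derivative relative to [I]: two-sided at an interior point,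
   one-sided at an endpoint belonging to [I].  It determines [g] on [I] as soon
   as the interval [I] has two points; on a one-point set it is vacuous. *)
Fixpoint is_derive_n_on (I : R -> Prop) (k : nat) (f g : R -> R) : Prop :=
  match k with
  | O => forall x : R, I x -> g x = f x
  | S k' => exists h : R -> R,
      is_derive_n_on I k' f h /\ (forall x : R, I x -> D_in h g I x)
  end.

Definition log_completely_monotonic (I : R -> Prop) (f : R -> R) : Prop :=
  (forall x : R, I x -> 0 < f x) /\
  (forall k : nat, exists g : R -> R, is_derive_n_on I k f g) /\
  (forall k : nat, (1 <= k)%nat ->
     exists g : R -> R,
       is_derive_n_on I k (fun x => ln (f x)) g /\
       (forall x : R, I x -> 0 <= (-1) ^ k * g x)).

(* Main.v *)
Require Import Defs.
From Stdlib Require Import Reals.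
From Stdlib Require Import Lra Lia.

Local Open Scope R_scope.

(** With [L := sum_i alpha_i ln f_i] the product equals [exp L] and its logarithm
    is [L].  Differentiation is linear, so the signs of the derivatives of [L]
    follow from those of the [ln f_i]; and [exp L] is smooth because
    [(exp L)' = L' exp L], by induction on the order of differentiation. *)

(** [D_in] sees only values at points of [I], here including [x] itself. Such a transfer is needed
    because order zero of [is_derive_n_on] is mere equality on [I]. *)
Lemma D_in_ext (I : R -> Prop) (f f' g g' : R -> R) (x : R) :
  (forall y, I y -> f y = f' y) -> (forall y, I y -> g y = g' y) -> I x ->
  D_in f g I x -> D_in f' g' I x.
Proof.
  intros Hf Hg Hx H eps Heps.
  destruct (H eps Heps) as [d [Hd Hlim]].
  exists d; split; [exact Hd|].
  intros y [[Iy Ny] Hy].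
  rewrite <- (Hf y Iy), <- (Hf x Hx), <- (Hg x Hx).
  apply Hlim; repeat split; assumption.
Qed.

Lemma D_in_exp (I : R -> Prop) (f g : R -> R) (x : R) :
  D_in f g I x -> D_in (fun y => exp (f y)) (fun y => g y * exp (f y)) I x.
Proof.
  intros H.
  assert (Hexp : D_in exp exp no_cond (f x))
    by apply derivable_pt_lim_D_in, derivable_pt_lim_exp.
  pose proof (Dcomp _ _ _ _ _ _ _ H Hexp) as Hc.
  (* [Hc] is a limit along [Dgf I no_cond f], which is [I] with a trivially true condition added;
     unfolding the limit returns to [I]. *)
  intros eps Heps.
  destruct (Hc eps Heps) as [d [Hd Hlim]].
  exists d; split; [exact Hd|].
  intros y [[Iy Ny] Hy].
  apply Hlim; repeat split; assumption.
Qed.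

Lemma is_derive_n_on_ext (I : R -> Prop) (k : nat) (f f' g : R -> R) :
  (forall x, I x -> f x = f' x) ->
  is_derive_n_on I k f g -> is_derive_n_on I k f' g.
Proof.
  intros Hf; revert g; induction k as [|k IH]; simpl; intros g H.
  - intros x Hx; rewrite <- Hf by exact Hx; now apply H.
  - destruct H as [h [Hh HD]]; exists h; split; [now apply IH | exact HD].
Qed.

Lemma is_derive_n_on_plus (I : R -> Prop) (k : nat) (f1 f2 g1 g2 : R -> R) :
  is_derive_n_on I k f1 g1 -> is_derive_n_on I k f2 g2 ->
  is_derive_n_on I k (fun x => f1 x + f2 x) (fun x => g1 x + g2 x).
Proof.
  revert g1 g2; induction k as [|k IH]; simpl; intros g1 g2 H1 H2.
  - intros x Hx; rewrite H1, H2 by exact Hx; reflexivity.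
  - destruct H1 as [h1 [Hh1 D1]]; destruct H2 as [h2 [Hh2 D2]].
    exists (fun x => h1 x + h2 x); split; [now apply IH|].
    intros x Hx; apply Dadd; auto.
Qed.

Lemma is_derive_n_on_scal (I : R -> Prop) (k : nat) (a : R) (f g : R -> R) :
  is_derive_n_on I k f g ->
  is_derive_n_on I k (fun x => a * f x) (fun x => a * g x).
Proof.
  revert g; induction k as [|k IH]; simpl; intros g H.
  - intros x Hx; rewrite H by exact Hx; reflexivity.
  - destruct H as [h [Hh HD]].
    exists (fun x => a * h x); split; [now apply IH|].
    intros x Hx; apply Dmult_const; auto.
Qed.

(* [is_derive_n_on] differentiates last; this peels off the first derivative. *)
Lemma is_derive_n_on_S (I : R -> Prop) (k : nat) (f g : R -> R) :
  is_derive_n_on I (S k) f g <->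
  exists h, (forall x, I x -> D_in f h I x) /\ is_derive_n_on I k h g.
Proof.
  revert g; induction k as [|k IH]; intros g; split.
  (* At order one, both sides say that [g] is the derivative of [f], up to replacing a function by
     one equal to it on [I]. *)
  - intros [h [Hh HD]]; exists g; split; [|now intros x Hx].
    intros x Hx; apply (D_in_ext I h f g g); auto.
  - intros [h [HD Hh]]; exists f; split; [now intros x Hx|].
    intros x Hx; apply (D_in_ext I f f h g); auto.
    intros y Hy; symmetry; auto.
  - intros [h [Hh HD]]; apply IH in Hh; destruct Hh as [u [Hu Huh]].
    exists u; split; [exact Hu|]; exists h; auto.
  - intros [u [Hu [h [Hh HD]]]].
    exists h; split; [apply IH; exists u; auto | exact HD].
Qed.

(** Hiding the witness avoids closed formulas for higher derivatives of products and exponentials: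
    only first derivatives need to be exhibited. *)
Definition n_differentiable_on (I : R -> Prop) (k : nat) (f : R -> R) : Prop :=
  exists g, is_derive_n_on I k f g.

Lemma n_differentiable_on_S (I : R -> Prop) (k : nat) (f : R -> R) :
  n_differentiable_on I (S k) f <->
  exists h, (forall x, I x -> D_in f h I x) /\ n_differentiable_on I k h.
Proof.
  split.
  - intros [g Hg]; apply is_derive_n_on_S in Hg; destruct Hg as [h [HD Hh]].
    exists h; split; [exact HD | now exists g].
  - intros [h [HD [g Hg]]]; exists g; apply is_derive_n_on_S; exists h; auto.
Qed.

Lemma n_differentiable_on_pred (I : R -> Prop) (k : nat) (f : R -> R) :
  n_differentiable_on I (S k) f -> n_differentiable_on I k f.
Proof. intros [g [h [Hh _]]]; now exists h. Qed.

Lemma n_differentiable_on_plus (I : R -> Prop) (k : nat) (f g : R -> R) :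
  n_differentiable_on I k f -> n_differentiable_on I k g ->
  n_differentiable_on I k (fun x => f x + g x).
Proof.
  intros [u Hu] [v Hv]; exists (fun x => u x + v x).
  now apply is_derive_n_on_plus.
Qed.

(** By the Leibniz rule the derivative is a sum of two new products, so the induction ranges over
    all pairs. Each product keeps one undifferentiated factor, whose order is lowered from [S k] to
    [k]. *)
Lemma n_differentiable_on_mult (I : R -> Prop) (k : nat) (f g : R -> R) :
  n_differentiable_on I k f -> n_differentiable_on I k g ->
  n_differentiable_on I k (fun x => f x * g x).
Proof.
  revert f g; induction k as [|k IH]; intros f g Hf Hg.
  - exists (fun x => f x * g x); now intros x Hx.
  - pose proof (n_differentiable_on_pred _ _ _ Hf) as Hf0.
    pose proof (n_differentiable_on_pred _ _ _ Hg) as Hg0.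
    apply n_differentiable_on_S in Hf; destruct Hf as [u [Du Hu]].
    apply n_differentiable_on_S in Hg; destruct Hg as [v [Dv Hv]].
    apply n_differentiable_on_S.
    exists (fun x => u x * g x + f x * v x); split.
    + intros x Hx; apply Dmult; auto.
    + apply n_differentiable_on_plus; apply IH; assumption.
Qed.

Lemma n_differentiable_on_exp (I : R -> Prop) (k : nat) (f : R -> R) :
  n_differentiable_on I k f -> n_differentiable_on I k (fun x => exp (f x)).
Proof.
  induction k as [|k IH]; intros Hf.
  - exists (fun x => exp (f x)); now intros x Hx.
  - pose proof (n_differentiable_on_pred _ _ _ Hf) as Hf0.
    apply n_differentiable_on_S in Hf; destruct Hf as [u [Du Hu]].
    apply n_differentiable_on_S.
    exists (fun x => u x * exp (f x)); split.
    + intros x Hx; apply D_in_exp; auto.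
    (* [IH] applied to [Hf0] handles the factor [exp (f x)], and [Hu] the factor [u]. *)
    + apply n_differentiable_on_mult; auto.
Qed.

(** The same nonnegative combination of the given derivatives serves as witness. Derivative and sign
    stay in one existential, since the sign is known only for the chosen [g]. *)
Lemma signed_derive_n_on_sum (I : R -> Prop) (k m : nat)
    (l : nat -> R -> R) (a : nat -> R) :
  (forall j, (j <= m)%nat -> 0 <= a j) ->
  (forall j, (j <= m)%nat -> exists g, is_derive_n_on I k (l j) g /\
     (forall x, I x -> 0 <= (-1) ^ k * g x)) ->
  exists g, is_derive_n_on I k (fun x => sum_f_R0 (fun j => a j * l j x) m) g /\
    (forall x, I x -> 0 <= (-1) ^ k * g x).
Proof.
  intros Ha Hl; induction m as [|m IH].
  - destruct (Hl 0%nat (le_n _)) as [g [Hg Sg]].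
    exists (fun x => a 0%nat * g x); split; [now apply is_derive_n_on_scal|].
    intros x Hx.
    pose proof (Rmult_le_pos _ _ (Ha 0%nat (le_n _)) (Sg x Hx)); lra.
  - destruct IH as [u [Hu Su]]; [intros; apply Ha; lia | intros; apply Hl; lia |].
    destruct (Hl (S m) (le_n _)) as [g [Hg Sg]].
    exists (fun x => u x + a (S m) * g x); split.
    + apply is_derive_n_on_plus; [exact Hu | now apply is_derive_n_on_scal].
    + intros x Hx; pose proof (Su x Hx).
      pose proof (Rmult_le_pos _ _ (Ha (S m) (le_n _)) (Sg x Hx)); lra.
Qed.

(** [Rpower x y] unfolds to [exp (y * ln x)], so the functional equation of [exp] suffices. *)
Lemma prod_Rpower_exp_sum (b a : nat -> R) (m : nat) :
  prod_f_R0 (fun j => Rpower (b j) (a j)) m =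
  exp (sum_f_R0 (fun j => a j * ln (b j)) m).
Proof.
  induction m as [|m IH]; simpl; [reflexivity|].
  now rewrite IH, exp_plus.
Qed.

(* Stdlib world.  [prod_f_R0 u (n - 1)] is the product of u 0, ..., u (n - 1). *)
Theorem theorem7 (I : R -> Prop) (hI : is_interval I)
    (n : nat) (hn : (1 <= n)%nat)
    (f : nat -> R -> R) (alpha : nat -> R)
    (hf : forall i : nat, (1 <= i <= n)%nat -> log_completely_monotonic I (f i))
    (halpha : forall i : nat, (1 <= i <= n)%nat -> 0 <= alpha i) :
  log_completely_monotonic I
    (fun x : R => prod_f_R0 (fun j : nat => Rpower (f (S j) x) (alpha (S j))) (n - 1)).
Proof.
  (* As [j] runs from 0 to [n - 1], [S j] runs from 1 to [n]; [hn] makes the truncated subtraction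
     exact. *)
  set (L := fun x => sum_f_R0 (fun j => alpha (S j) * ln (f (S j) x)) (n - 1)).
  assert (HP : forall x,
    prod_f_R0 (fun j => Rpower (f (S j) x) (alpha (S j))) (n - 1) = exp (L x))
    by (intros x; apply prod_Rpower_exp_sum).
  assert (HL : forall k, (1 <= k)%nat -> exists g, is_derive_n_on I k L g /\
            (forall x, I x -> 0 <= (-1) ^ k * g x)).
  { intros k Hk.
    apply (signed_derive_n_on_sum I k (n - 1) (fun j x => ln (f (S j) x))
             (fun j => alpha (S j))).
    - intros j Hj; apply halpha; lia.
    - intros j Hj; apply (hf (S j)); [lia | exact Hk]. }
  split; [|split].
  - intros x _; rewrite HP; apply exp_pos.
  - intros k.
    (* [HL] starts at order 1, while [k] may be 0 here: differentiability is taken at order [S k]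
       and lowered by one. *)
    assert (HLk : n_differentiable_on I k L).
    { apply n_differentiable_on_pred.
      destruct (HL (S k)) as [g [Hg _]]; [lia | now exists g]. }
    destruct (n_differentiable_on_exp _ _ _ HLk) as [g Hg]; exists g.
    apply (is_derive_n_on_ext I k (fun x => exp (L x))); [|exact Hg].
    intros x _; symmetry; apply HP.
  - intros k Hk; destruct (HL k Hk) as [g [Hg Sg]]; exists g; split; [|exact Sg].
    apply (is_derive_n_on_ext I k L); [|exact Hg].
    intros x _; rewrite HP; symmetry; apply ln_exp.
Qed.
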